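(* Let $S$ be a quasi-complete range set with countable coinitiality. Let $X$ be a second countable, locally compact, locally non-discrete $S$-valued ultrametrizable topological space. Then for every $S$-ultra-singular transmissible parameter $\mathfrak{G}$, the set of all $d\in\mathrm{UM}(X,S)$ for which $(X,d)$ satisfies the local anti-$\mathfrak{G}$-transmissible property is a dense $G_\delta$ set in the space $(\mathrm{UM}(X,S),\mathcal{UD}_X^S)$.
   Context: A range set is a set $S\subseteq[0,\infty)$ with $0\in S$. It is quasi-complete if for some $C\in[1,\infty)$, for every bounded $E\subseteq S$ there is $s\in S$ with $\sup E\le s\le C\sup E$ (suprema in $[0,\infty]$). It has countable coinitiality if there is a strictly decreasing sequence in $S$ converging to $0$. A metric $d$ on $X$ is an ultrametric if $d(x,y)\le d(x,z)\lor d(z,y)$ for all $x,y,z$ ($\lor$ = maximum); it is $S$-valued if $d(X^2)\subseteq S$. For a topological space $X$, $\mathrm{M}(X)$ (resp. $\mathrm{UM}(X,S)$) is the set of all metrics (resp. $S$-valued ultrametrics) on $X$ generating the topology of $X$; $X$ is $S$-valued ultrametrizable if $\mathrm{UM}(X,S)\ne\emptyset$. $\mathcal{D}_X(d,e)=\sup_{x,y\in X}|d(x,y)-e(x,y)|\in[0,\infty]$ is a ($[0,\infty]$-valued) metric on $\mathrm{M}(X)$. For $d,e\in\mathrm{UM}(X,S)$, $\mathcal{UD}_X^S(d,e)\in[0,\infty]$ is the infimum of $\epsilon\in S\sqcup\{\infty\}$ such that $d(x,y)\le e(x,y)\lor\epsilon$ and $e(x,y)\le d(x,y)\lor\epsilon$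 for all $x,y\in X$; it is a ($[0,\infty]$-valued) ultrametric on $\mathrm{UM}(X,S)$. $X$ is locally non-discrete if every non-empty open subspace of $X$ is non-discrete. $\mathbb{N}$ is the set of positive integers, $\mathcal{P}^*(\mathbb{N})$ the set of non-empty subsets of $\mathbb{N}$, $\mathcal{F}(T)$ the set of closed subsets of a topological space $T$. For $W\in\mathcal{P}^*(\mathbb{N})$ and a set $E$, $\mathrm{Seq}(W,E)$ is the set of all finite injective sequences $\{a_i\}_{i=1}^n$ in $E$ with $n\in W$. A transmissible parameter is a sextuple $\mathfrak{G}=(Q,P,F,G,Z,\phi)$, where $Q$ is an at most countable set, $P$ a topological space, $F:Q\to\mathcal{F}(P)$ and $G:Q\to\mathcal{P}^*(\mathbb{N})$ maps, $Z$ a set, and $\phi$ assigns to each $q\in Q$ and each metrizable space $X$ a map $\phi^{q,X}:\mathrm{Seq}(G(q),X)\times Z\times\mathrm{M}(X)\to P$, such that for every metrizable space $X$, $q\in Q$, $z\in Z$: (TP1) for every $a\in\mathrm{Seq}(G(q),X)$ the map $d\mapsto\phi^{q,X}(a,z,d)$ from $(\mathrm{M}(X),\mathcal{D}_X)$ to $P$ is continuous; (TP2) for every $d\in\mathrm{M}(X)$, every subset $B\subseteq X$ and every $a\in\mathrm{Seq}(G(q),B)$, $\phi^{q,X}(a,z,d)=\phi^{q,B}(a,z,d|_{B^2})$. A metric space $(X,d)$ satisfies the $\mathfrak{G}$-transmissible property if there is $q\in Q$ such that for all $z\in Z$ and all $a\in\mathrm{Seq}(G(q),X)$, $\phi^{q,X}(a,z,d)\in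 F(q)$. It satisfies the anti-$\mathfrak{G}$-transmissible property if it does not satisfy the $\mathfrak{G}$-transmissible property, i.e. for every $q\in Q$ there exist $z\in Z$ and $a\in\mathrm{Seq}(G(q),X)$ with $\phi^{q,X}(a,z,d)\in P\setminus F(q)$. For a property of metric spaces, $(X,d)$ satisfies the local version of the property if every non-empty open metric subspace of $X$ satisfies the property. $\mathfrak{G}$ is $S$-ultra-singular if for each $q\in Q$ and every $\epsilon\in(0,\infty)$ there exist $z\in Z$, a finite $S$-valued ultrametric space $(R,d_R)$ and an enumeration $R=\{r_i\}_{i=1}^{\mathrm{card}(R)}$ such that: the diameter of $(R,d_R)$ is at most $\epsilon$; $\mathrm{card}(R)\in G(q)$; and $\phi^{q,R}(\{r_i\}_{i=1}^{\mathrm{card}(R)},z,d_R)\in P\setminus F(q)$.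
   Formalization: Condition (TP2) is assumed for every isometric embedding of a metric space B into X, not only for literal subsets B of X, so the maps φ are invariant under isometric relabelling of points; without this the claim fails, e.g. when φ tests whether a point equals one fixed set. *)

(* Defs.v *)
From HB Require Import structures.
From mathcomp Require Import all_boot all_order all_algebra.
From mathcomp Require Import all_classical all_reals all_analysis.
From mathcomp Require Import borel_hierarchy.

Set Implicit Arguments.
Unset Strict Implicit.
Unset Printing Implicit Defensive.

Import Order.TTheory GRing.Theory Num.Theory.
Import numFieldNormedType.Exports.

Local Open Scope classical_set_scope.
Local Open Scope ring_scope.

Record range_set (R : realType) := RangeSet {
  range_set_carrier :> R -> Prop;
  range_set_ge0 : forall s, range_set_carrier s -> 0 <= s;
  range_set0 : range_set_carrier 0 }.

(* [sup set0 = 0] in the library, which is the supremum of the empty set in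
   [0, +oo]; on nonempty bounded sets [sup] is the usual supremum. *)
Definition quasi_complete (R : realType) (S : range_set R) :=
  exists2 C : R, 1 <= C &
    forall E : set R, E `<=` S -> bounded_set E ->
      exists2 s, S s & sup E <= s <= C * sup E.

Definition countable_coinitiality (R : realType) (S : range_set R) :=
  exists u : R^nat,
    [/\ (forall n, S (u n)), (forall n, u n.+1 < u n) & u @ \oo --> 0].

Definition is_metric (R : realType) (T : Type) (d : T -> T -> R) :=
  [/\ forall x y, 0 <= d x y,
      forall x y, d x y = 0 <-> x = y,
      forall x y, d x y = d y x &
      forall x y z, d x y <= d x z + d z y].

Definition generates_topology (R : realType) (X : topologicalType)
    (d : X -> X -> R) :=
  forall U : set X, open U <->
    forall x, U x -> exists2 e, 0 < e & [set y | d x y < e] `<=` U.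

(* The set M(X); it is empty when X is not metrizable. *)
Record metrics (R : realType) (X : topologicalType) := Metrics {
  metric_fun :> X -> X -> R;
  metricP : is_metric metric_fun;
  metric_topology : generates_topology metric_fun }.

(* The set UM(X, S). *)
Record ultrametrics (R : realType) (S : range_set R) (X : topologicalType) :=
  Ultrametrics {
    ultrametric_metric :> metrics R X;
    ultrametricP : forall x y z,
      ultrametric_metric x y <=
        Num.max (ultrametric_metric x z) (ultrametric_metric z y);
    ultrametric_valued : forall x y, S (ultrametric_metric x y) }.

Section Distances.
Context {R : realType}.
Local Open Scope ereal_scope.

(* Adding 0 makes the supremum of the empty set 0, as in [0, +oo]. *)
Definition sup0 (A : set (\bar R)) : \bar R := ereal_sup (0 |` A).

Definition diameter (X : topologicalType) (d : metrics R X) : \bar R :=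
  sup0 [set (d p.1 p.2)%:E | p in [set: X * X]].

Definition dist_M (X : topologicalType) (d e : metrics R X) : \bar R :=
  sup0 [set `|d p.1 p.2 - e p.1 p.2|%:E | p in [set: X * X]].

Definition dist_UM (S : range_set R) (X : topologicalType)
    (d e : ultrametrics S X) : \bar R :=
  ereal_inf [set eps | (eps = +oo \/ exists2 s, S s & eps = s%:E) /\
    forall x y, (d x y)%:E <= maxe (e x y)%:E eps /\
                (e x y)%:E <= maxe (d x y)%:E eps].

End Distances.

Section MetricsSpace.
Context {R : realType} {X : topologicalType}.
Implicit Types (d e f : metrics R X) (r : R).

Definition ball_M d r : set (metrics R X) := [set e | (dist_M d e < r%:E)%E].

Lemma dist_M_ge0 d e : (0 <= dist_M d e)%E.
Proof. by apply: ereal_sup_ubound; left. Qed.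

Lemma dist_M_sym d e : dist_M d e = dist_M e d.
Proof.
by rewrite /dist_M; congr (sup0 _); apply: eq_imagel => p _; rewrite distrC.
Qed.

Lemma dist_M_triangle d e f : (dist_M d f <= dist_M d e + dist_M e f)%E.
Proof.
apply: ge_ereal_sup => _ [->|[p _ <-]].
  by apply: adde_ge0; exact: dist_M_ge0.
apply: (@le_trans _ _ (`|d p.1 p.2 - e p.1 p.2|%:E +
                       `|e p.1 p.2 - f p.1 p.2|%:E)%E).
  by rewrite -EFinD lee_fin; exact: ler_distD.
by apply: leeD; apply: ereal_sup_ubound; right; exists p.
Qed.

Lemma ball_M_center d r : 0 < r -> ball_M d r d.
Proof.
move=> r0; rewrite /ball_M /=; apply: (@le_lt_trans _ _ 0%E).
  by apply: ge_ereal_sup => _ [->//|[p _ <-]]; rewrite subrr normr0.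
by rewrite lte_fin.
Qed.

Lemma ball_M_sym d e r : ball_M d r e -> ball_M e r d.
Proof. by rewrite /ball_M /= dist_M_sym. Qed.

Lemma ball_M_triangle d e f r s :
  ball_M d r e -> ball_M e s f -> ball_M d (r + s) f.
Proof.
rewrite /ball_M /= => de ef; apply: le_lt_trans (dist_M_triangle d e f) _.
by rewrite EFinD; apply: lteD.
Qed.

HB.instance Definition _ := gen_eqMixin (metrics R X).
HB.instance Definition _ := gen_choiceMixin (metrics R X).
HB.instance Definition _ :=
  hasNbhs.Build (metrics R X) (nbhs_ (entourage_ ball_M)).
HB.instance Definition _ := @Nbhs_isPseudoMetric.Build R (metrics R X)
  (entourage_ ball_M) erefl ball_M ball_M_center ball_M_sym ball_M_triangle
  erefl.

End MetricsSpace.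

Section UltrametricsSpace.
Context {R : realType} {S : range_set R} {X : topologicalType}.
Implicit Types (d e f : ultrametrics S X) (r : R).

Definition ball_UM d r : set (ultrametrics S X) :=
  [set e | (dist_UM d e < r%:E)%E].

Lemma ball_UM_center d r : 0 < r -> ball_UM d r d.
Proof.
move=> r0; rewrite /ball_UM /=; apply: (@le_lt_trans _ _ 0%E).
  apply: ereal_inf_lbound; split; first by right; exists 0 => //; exact: range_set0.
  by move=> x y; rewrite le_max lexx.
by rewrite lte_fin.
Qed.

Lemma ball_UM_sym d e r : ball_UM d r e -> ball_UM e r d.
Proof.
rewrite /ball_UM /dist_UM /=; congr (_ < _)%E; congr ereal_inf.
by apply/seteqP; split => eps [Seps H]; split => // x y; have [] := H x y.
Qed.

Lemma ball_UM_triangle d e f r s :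
  ball_UM d r e -> ball_UM e s f -> ball_UM d (r + s) f.
Proof.
have ge0 (eps : \bar R) :
    eps = +oo%E \/ (exists2 s, S s & eps = s%:E) -> (0 <= eps)%E.
  by move=> [->//|[t /range_set_ge0 t0 ->]]; rewrite lee_fin.
move=> /ereal_inf_lt[a [Sa Ha] ar] /ereal_inf_lt[b [Sb Hb] bs].
have [a0 b0] := (ge0 _ Sa, ge0 _ Sb).
have Hab x y : ((d x y)%:E <= maxe (f x y)%:E (maxe a b))%E /\
               ((f x y)%:E <= maxe (d x y)%:E (maxe a b))%E.
  have [de ed] := Ha x y; have [ef fe] := Hb x y; split.
    apply: le_trans de _; rewrite ge_max; apply/andP; split.
      by apply: le_trans ef _; rewrite ge_max !le_max !lexx ?orbT.
    by rewrite !le_max lexx ?orbT.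
  apply: le_trans fe _; rewrite ge_max; apply/andP; split.
    by apply: le_trans ed _; rewrite ge_max !le_max !lexx ?orbT.
  by rewrite !le_max lexx ?orbT.
rewrite /ball_UM /=; apply: (@le_lt_trans _ _ (maxe a b)).
  by apply: ereal_inf_lbound; split => //; rewrite /maxe; case: ifP.
rewrite EFinD gt_max; apply/andP; split.
  apply: lt_le_trans ar _; rewrite leeDl //.
  exact: le_trans b0 (ltW bs).
apply: lt_le_trans bs _; rewrite leeDr //.
exact: le_trans a0 (ltW ar).
Qed.

HB.instance Definition _ := gen_eqMixin (ultrametrics S X).
HB.instance Definition _ := gen_choiceMixin (ultrametrics S X).
HB.instance Definition _ :=
  hasNbhs.Build (ultrametrics S X) (nbhs_ (entourage_ ball_UM)).
HB.instance Definition _ := @Nbhs_isPseudoMetric.Build R (ultrametrics S X)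
  (entourage_ ball_UM) erefl ball_UM ball_UM_center ball_UM_sym
  ball_UM_triangle erefl.

End UltrametricsSpace.

Section Restriction.
Context {R : realType} {X : topologicalType} (B : set X) (d : metrics R X).

Definition restr_fun (x y : B) : R := d (set_val x) (set_val y).

Lemma restr_metricP : is_metric restr_fun.
Proof.
have [d0 d1 d2 d3] := metricP d.
split => [x y|x y|x y|x y z]; rewrite /restr_fun //.
split => [/d1|->]; first exact: val_inj.
exact/d1.
Qed.

Lemma restr_topology : @generates_topology R B restr_fun.
Proof.
have [d0 d1 d2 d3] := metricP d.
move=> U; split => [[V oV <-] x /= Vx|H].
  have [e e0 He] := (metric_topology d V).1 oV _ Vx.
  by exists e => // y /= dxy; apply: He.
pose V := \bigcup_(p in [set p : B * R | U p.1 /\ 0 < p.2 /\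
   [set y | restr_fun p.1 y < p.2] `<=` U]) [set y | d (set_val p.1) y < p.2].
exists V.
  apply/(metric_topology d) => y [[x e] /= [Ux [e0 He]]] dxy.
  exists (e - d (set_val x) y); first by rewrite subr_gt0.
  move=> z /= yz; exists (x, e) => //=.
  by apply: le_lt_trans (d3 _ _ y) _; rewrite -ltrBrDl.
apply/seteqP; split => x.
  by move=> [[y e] /= [Uy [e0 He]]] dyx; apply: He.
move=> Ux; have [e e0 He] := H x Ux.
by exists (x, e) => //=; rewrite (d1 _ _).2.
Qed.

Definition restr_metric : metrics R B := Metrics restr_metricP restr_topology.

End Restriction.

Record inj_seq (W : set nat) (E : Type) := InjSeq {
  inj_seq_size : nat;
  inj_seq_fun :> 'I_inj_seq_size -> E;
  inj_seq_sizeP : W inj_seq_size;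
  inj_seqP : injective inj_seq_fun }.

Definition inj_seq_map (W : set nat) (E E' : Type) (f : E -> E')
    (finj : injective f) (a : inj_seq W E) : inj_seq W E' :=
  InjSeq (inj_seq_sizeP a) (inj_comp finj (@inj_seqP _ _ a)).

(* [tp_phi] takes an element of [metrics R X], hence it is only defined on
   metrizable spaces.
   Types, unlike sets, are not literally subsets of one another: in [TP2] the
   metric subspace (B, d|B^2) of (X, d) is a space B given with an injection
   i : B -> X along which its metric is the one of X; a subset B of X with its
   inclusion is the case i := set_val.  So [tp_phi] does not depend on the names
   of the points, which a set-theoretic reading leaves implicit but which is
   needed to apply the parameter to copies of a space. *)
Record transmissible_parameter (R : realType) := TransmissibleParameter {
  tp_Q : Type;
  tp_P : topologicalType;
  tp_F : tp_Q -> set tp_P;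
  tp_G : tp_Q -> set nat;
  tp_Z : Type;
  tp_phi : forall (q : tp_Q) (X : topologicalType),
    inj_seq (tp_G q) X -> tp_Z -> metrics R X -> tp_P;
  tp_Q_countable : countable [set: tp_Q];
  tp_F_closed : forall q, closed (tp_F q);
  tp_G_neq0 : forall q, tp_G q !=set0;
  tp_G_gt0 : forall q n, tp_G q n -> (0 < n)%N;
  TP1 : forall q (X : topologicalType) (a : inj_seq (tp_G q) X) (z : tp_Z),
    continuous (tp_phi a z);
  TP2 : forall q (X B : topologicalType) (i : B -> X) (iinj : injective i)
      (d : metrics R X) (dB : metrics R B),
    (forall x y, dB x y = d (i x) (i y)) ->
    forall (a : inj_seq (tp_G q) B) (z : tp_Z),
      tp_phi (inj_seq_map iinj a) z d = tp_phi a z dB }.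

Definition transmissible (R : realType) (GG : transmissible_parameter R)
    (X : topologicalType) (d : metrics R X) : Prop :=
  exists q : tp_Q GG, forall (z : tp_Z GG) (a : inj_seq (tp_G q) X),
    tp_F q (tp_phi a z d).

Definition anti_transmissible (R : realType) (GG : transmissible_parameter R)
    (X : topologicalType) (d : metrics R X) : Prop :=
  ~ transmissible GG d.

Definition local_property (R : realType)
    (Pr : forall X : topologicalType, metrics R X -> Prop)
    (X : topologicalType) (d : metrics R X) : Prop :=
  forall U : set X, open U -> U !=set0 -> Pr U (restr_metric U d).

Definition ultra_singular (R : realType) (S : range_set R)
    (GG : transmissible_parameter R) : Prop :=
  forall (q : tp_Q GG) (eps : R), 0 < eps ->
    exists (z : tp_Z GG) (Y : topologicalType) (dY : ultrametrics S Y)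
           (r : inj_seq (tp_G q) Y),
      [/\ finite_set [set: Y],
          (forall y, exists i, r i = y),
          (diameter dY <= eps%:E)%E &
          ~ tp_F q (tp_phi r z dY)].

Definition is_discrete (X : topologicalType) := forall A : set X, open A.

Definition locally_non_discrete (X : topologicalType) :=
  forall U : set X, open U -> U !=set0 -> ~ is_discrete U.

Definition ultrametrizable (R : realType) (S : range_set R)
    (X : topologicalType) := inhabited (ultrametrics S X).

(* Main.v *)
(** Call [violates_in U q d] the existence of a tuple of points of U witnessing
    that (X, d) fails the condition of index q.  For a countable base of X the
    metrics wanted are those satisfying countably many such conditions, each of
    which is open by (TP1) and (TP2).

    Density needs no Baire argument.  Starting from d, one runs through these
    conditions; at step n the current metric is changed only on pairs of points
    of a small ball B n inside the given open set, where a finite space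
    violating the condition is implanted.  The ball avoids the points used at
    earlier steps, so earlier violations survive.  As the d-diameters of the
    B n tend to 0, each distance changes finitely often, and the limit generates
    the topology: near a point lying in finitely many B n it agrees with one of
    the metrics constructed, and at any other point the B n containing it form
    a neighbourhood basis for both metrics. *)
Require Import Defs.
From mathcomp Require Import all_boot all_order all_algebra.
From mathcomp Require Import all_classical all_reals all_analysis.
From mathcomp Require Import borel_hierarchy lra.

Import Order.TTheory GRing.Theory Num.Theory.

Local Open Scope classical_set_scope.

(** * Ultrametrics and comparison of their topologies *)

Section UltrametricFacts.
Local Open Scope ring_scope.
Context {R : realType} {S : range_set R} {X : topologicalType}.
Implicit Types d e : ultrametrics S X.

Lemma ultrametric_ge0 d x y : 0 <= d x y.
Proof. by have [] := metricP d. Qed.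

Lemma ultrametric_refl d x : d x x = 0.
Proof. by have [_ d1 _ _] := metricP d; apply/d1. Qed.

Lemma ultrametric_eq0 d x y : d x y = 0 -> x = y.
Proof. by have [_ d1 _ _] := metricP d; move/d1. Qed.

Lemma ultrametric_gt0 d x y : x <> y -> 0 < d x y.
Proof.
by move=> xy; rewrite lt0r ultrametric_ge0 andbT; apply/eqP => /ultrametric_eq0.
Qed.

Lemma ultrametric_sym d x y : d x y = d y x.
Proof. by have [] := metricP d. Qed.

Lemma ultrametric_open_ball d x r : open [set y | d x y < r].
Proof.
apply/(metric_topology d) => y /= xy; exists r.
  by apply: le_lt_trans xy; exact: ultrametric_ge0.
by move=> z /= yz; rewrite (le_lt_trans (ultrametricP d x z y))// gt_max xy.
Qed.

Lemma ultrametric_in_open d (U : set X) x : open U -> U x ->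
  exists2 r, 0 < r & forall y, d x y < r -> U y.
Proof. by move=> /(metric_topology d) /[apply]. Qed.

Lemma ultrametric_equivalent d e x eps : 0 < eps ->
  exists2 r, 0 < r & forall y, d x y < r -> e x y < eps.
Proof.
move=> eps0; apply: (@ultrametric_in_open d [set y | e x y < eps]).
  exact: ultrametric_open_ball.
by rewrite /= ultrametric_refl.
Qed.

(** Comparing balls at each point gives [f] the topology of [e]. The last hypothesis also yields
    separation: [f x y = 0] puts [e x y] below every positive number. *)
Lemma ultrametrics_of (f : X -> X -> R) e :
    (forall x, f x x = 0) -> (forall x y, f x y = f y x) ->
    (forall x y z, f x y <= Num.max (f x z) (f z y)) ->
    (forall x y, S (f x y)) ->
    (forall x eps, 0 < eps ->
      exists2 r, 0 < r & forall y, e x y < r -> f x y < eps) ->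
    (forall x eps, 0 < eps ->
      exists2 r, 0 < r & forall y, f x y < r -> e x y < eps) ->
  exists d, forall x y, d x y = f x y.
Proof.
move=> fxx fC fU fS ef fe.
have f_ge0 x y : 0 <= f x y by exact: range_set_ge0 (fS x y).
have fP : is_metric f.
  split => // [x y|x y z].
    split => [fxy|<-//]; apply: (ultrametric_eq0 e); apply/eqP.
    rewrite eq_le ultrametric_ge0 andbT; apply/ler_addgt0Pl => eps /fe.
    move=> /(_ x)[r r0 H]; rewrite addr0; apply/ltW/H; by rewrite fxy.
  by rewrite (le_trans (fU x y z))// ge_max lerDl lerDr !f_ge0.
have fT : generates_topology f.
  move=> U; split => [oU x Ux|H].
    have [r r0 Hr] := ultrametric_in_open e U x oU Ux.
    by have [t t0 Ht] := fe x r r0; exists t => // y /= /Ht; exact: Hr.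
  apply/(metric_topology e) => x Ux.
  have [r r0 Hr] := H x Ux; have [t t0 Ht] := ef x r r0.
  by exists t => // y /= /Ht; exact: Hr.
by exists (@Ultrametrics R S X (Metrics fP fT) fU fS).
Qed.

End UltrametricFacts.

(** * Gluing a finite ultrametric space into a ball *)

Section Implantation.
Local Open Scope ring_scope.
Context {R : realType} {S : range_set R} {X : topologicalType}.
Implicit Types d e : ultrametrics S X.

Lemma finite_positive_lower_bound (I : finType) (g : I -> R) :
  exists2 r, 0 < r & forall i, 0 < g i -> r <= g i.
Proof.
exists (\big[Num.min/1]_(i | 0 < g i) g i).
  by apply/bigmin_gtP; split.
by move=> i gi; exact: bigmin_le_cond.
Qed.

Lemma coinitial_below (r : R) : countable_coinitiality S -> 0 < r ->
  exists s, [/\ S s, 0 < s & s < r].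
Proof.
move=> [u [Su u_dec u0]] r0.
have u_gt0 n : 0 < u n.
  by apply: le_lt_trans (u_dec n); exact: range_set_ge0 (Su _).
have /cvgrPdist_lt/(_ _ r0)[N _ /(_ N (leqnn N))] := u0.
rewrite /= sub0r normrN gtr0_norm// => uN.
by exists (u N).
Qed.

(** Points outside the ball are at least [rho] from those inside, and new inner distances are at
    most [rho], so replacing only these keeps the strong triangle inequality. The topology survives
    because the finite space enters through a locally constant map. *)
Lemma implant_finite_space (hcc : countable_coinitiality S) e (p : X) (rho : R)
    (Y : topologicalType) (dY : ultrametrics S Y) (y0 : Y)
    (I : finType) (f : I -> X) (r : I -> Y) :
    0 < rho -> (forall y y', dY y y' <= rho) ->
    injective f -> injective r -> (forall i, e p (f i) < rho) ->
  exists e',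
    [/\ forall x y, ~ (e p x < rho /\ e p y < rho) -> e' x y = e x y,
        forall x y, e p x < rho -> e p y < rho -> e' x y <= rho &
        forall i j, e' (f i) (f j) = dY (r i) (r j)].
Proof.
move=> rho0 dY_rho finj rinj fB.
(* [delta] makes the [delta]-balls around the points [f i] disjoint; [t] bounds the positive
   distances of the implanted tuple from below. *)
have [delta delta0 deltaP] :=
  finite_positive_lower_bound _ (fun ij : I * I => e (f ij.1) (f ij.2)).
have [t t0 tP] :=
  finite_positive_lower_bound _ (fun ij : I * I => dY (r ij.1) (r ij.2)).
have [s [Ss s0]] : exists s, [/\ S s, 0 < s & s < Num.min t rho].
  by apply: coinitial_below => //; rewrite lt_min t0.
rewrite lt_min => /andP[st srho].
pose B x := e p x < rho.
have e_in x y : B x -> B y -> e x y < rho.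
  move=> Bx By; rewrite (le_lt_trans (ultrametricP e x y p))// gt_max.
  by rewrite ultrametric_sym; apply/andP.
have e_out x y : B x -> ~~ B y -> rho <= e x y.
  move=> Bx; apply: contraNle => exy.
  by rewrite /B (le_lt_trans (ultrametricP e p y x))// gt_max exy andbT.
(* [c] is [r i] on the [delta]-ball of [f i] and [y0] off these balls, hence constant on every
   [delta]-ball. *)
pose c x := if [pick i | e x (f i) < delta] is Some i then r i else y0.
have e_delta i j : e (f i) (f j) < delta -> i = j.
  move=> fij; apply: finj; apply: contrapT => nij.
  have := deltaP (i, j) (ultrametric_gt0 e _ _ nij).
  by rewrite leNgt fij.
have cf i : c (f i) = r i.
  rewrite /c; case: pickP => [j /e_delta -> //|/(_ i)].
  by rewrite ultrametric_refl delta0.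
have c_loc x y : e x y < delta -> c x = c y.
  move=> xy; have xy_i i : (e x (f i) < delta) = (e y (f i) < delta).
    apply/idP/idP => H.
      rewrite (le_lt_trans (ultrametricP e y (f i) x))// gt_max.
      by rewrite ultrametric_sym xy.
    by rewrite (le_lt_trans (ultrametricP e x (f i) y))// gt_max xy.
  by rewrite /c (eq_pick xy_i).
(* A maximum of two pseudo-ultrametrics.  As s is below all positive distances
   of the finite space, g (f i) (f j) is exactly dY (r i) (r j). *)
pose g x y := Num.max (Num.min (e x y) s) (dY (c x) (c y)).
pose h x y := if B x && B y then g x y else e x y.
have g_rho x y : g x y <= rho.
  by rewrite ge_max dY_rho andbT ge_min (ltW srho) orbT.
have gU x y z : g x y <= Num.max (g x z) (g z y).
  have dYU := ultrametricP dY (c x) (c y) (c z).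
  have eU := ultrametricP e x y z.
  rewrite /g ge_max; apply/andP; split; last first.
    by apply: le_trans dYU _; rewrite ge_max !le_max !(lexx, orbT).
  move: eU; rewrite !le_max !ge_min !le_min !(lexx, orbT, andbT).
  have [exs|/ltW exs] := leP (e x y) s; case/orP => H;
    by rewrite ?H ?(le_trans exs H) ?orbT// orbT.
have hB x y : B x -> B y -> h x y = g x y by rewrite /h => -> ->.
have hNl x y : ~~ B x -> h x y = e x y by rewrite /h => /negbTE ->.
have hNr x y : ~~ B y -> h x y = e x y.
  by rewrite /h => /negbTE ->; rewrite andbF.
have [e' e'h] : exists e', forall x y, e' x y = h x y.
  apply: (ultrametrics_of h e).
  - move=> x; rewrite /h /g (ultrametric_refl e) (ultrametric_refl dY).
    case: ifP => // _.
    by rewrite (min_l (ltW s0)) maxxx.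
  - move=> x y; rewrite /h andbC /g (ultrametric_sym e).
    by rewrite (ultrametric_sym dY).
  - move=> x y z.
    (* If only [z] is outside, both terms on the right are at least [rho]. If [z] is inside and one
       of [x], [y] is not, the distance across the boundary dominates. *)
    case: (boolP (B z)) => Bz; last first.
      rewrite !(hNl z, hNr _ z)//.
      case: (boolP (B x)) => Bx; last by rewrite hNl//; exact: ultrametricP.
      case: (boolP (B y)) => By; last by rewrite hNr//; exact: ultrametricP.
      by rewrite hB// (le_trans (g_rho _ _))// le_max e_out.
    case: (boolP (B x)) => Bx; last first.
      rewrite !(hNl x)// le_max.
      have := ultrametricP e x y z; rewrite le_max => /orP[->//|eyz].
      case: (boolP (B y)) => By; last by rewrite hNr// eyz orbT.
      apply/orP; left; apply: (le_trans eyz).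
      apply/ltW/(lt_le_trans (e_in _ _ Bz By)).
      by rewrite ultrametric_sym e_out.
    case: (boolP (B y)) => By; first by rewrite !hB.
    rewrite !(hNr _ y)// le_max.
    have := ultrametricP e x y z; rewrite le_max => /orP[exz|->]; last first.
      by rewrite orbT.
    apply/orP; right; apply: (le_trans exz).
    apply/ltW/(lt_le_trans (e_in _ _ Bx Bz)).
    exact: e_out.
  - move=> x y; rewrite /h /g; case: ifP => _; last exact: ultrametric_valued.
    have Smax a b : S a -> S b -> S (Num.max a b) by case: (leP a b).
    have Smin a b : S a -> S b -> S (Num.min a b) by case: (leP a b).
    by apply: (Smax); [apply: (Smin) => //|]; exact: ultrametric_valued.
  - move=> x eps eps0; case: (boolP (B x)) => Bx; last first.
      by exists eps => // y; rewrite hNl.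
    exists (Num.min (Num.min rho delta) eps).
      by rewrite !lt_min rho0 delta0.
    move=> y; rewrite !lt_min => /andP[/andP[exy_rho exy_delta] exy].
    case: (boolP (B y)) => By; last by rewrite hNr.
    rewrite hB// /g (c_loc _ _ exy_delta) ultrametric_refl gt_max eps0 andbT.
    by rewrite gt_min exy.
  - move=> x eps eps0; case: (boolP (B x)) => Bx; last first.
      by exists eps => // y; rewrite hNl.
    (* When [g x y < s] the cap at [s] is inactive, so [e x y <= g x y]. *)
    exists (Num.min s eps); first by rewrite lt_min s0.
    move=> y; rewrite lt_min; case: (boolP (B y)) => By; last first.
      by rewrite hNr// => /andP[].
    rewrite hB// /g !gt_max !gt_min ltxx orbF => /andP[/andP[exys _]].
    by move=> /andP[/orP[//|seps] _]; exact: lt_trans exys seps.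
exists e'; split.
- by move=> x y xy; rewrite e'h /h; case: ifP => // /andP xB; case: xy.
- by move=> x y Bx By; rewrite e'h hB.
- move=> i j; rewrite e'h hB; [|exact: fB..]; rewrite /g !cf max_r//.
  have [->|ij] := eqVneq i j.
    by rewrite ultrametric_refl ge_min ultrametric_refl lexx.
  rewrite ge_min orbC (le_trans (ltW st))// (tP (i, j))//.
  apply: ultrametric_gt0.
  by move=> /rinj/eqP; apply/negP.
Qed.
End Implantation.

(** * Limits of successively modified ultrametrics *)

Section Limit.
Local Open Scope ring_scope.
Context {R : realType} {S : range_set R} {X : topologicalType}.

(** The radii decrease strictly, so a later [B n] cannot meet both [B m] and its complement: such
    points are at least [rho m > rho n] apart. Hence [rho m] still separates [B m] from its
    complement in all later metrics and in the limit. *)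
Lemma ultrametric_limit (d : nat -> ultrametrics S X) (B : nat -> set X)
    (rho eps : nat -> R) :
    (forall n, 0 < rho n) -> (forall n, rho n.+1 < rho n) ->
    (forall n, rho n <= eps n) ->
    eps @ \oo --> 0 ->
    (forall n, open (B n)) ->
    (forall n x y, B n x -> B n y -> d 0%N x y <= eps n) ->
    (forall n x y, B n x -> B n y -> d n x y <= rho n) ->
    (forall n x y, B n x -> ~ B n y -> rho n <= d n x y) ->
    (forall n x y, B n x -> B n y -> d n.+1 x y <= rho n) ->
    (forall n x y, ~ (B n x /\ B n y) -> d n.+1 x y = d n x y) ->
  exists e : ultrametrics S X,
    forall x y, exists N, forall n, (N <= n)%N -> d n x y = e x y.
Proof.
move=> rho0 rhoS rho_eps epscvg oB d0B dB dBout dSB dS.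
have eps0 t : 0 < t -> exists N, forall n, (N <= n)%N -> eps n < t.
  move=> t0; have /cvgrPdist_lt/(_ _ t0)[N _ NP] := epscvg.
  exists N => n /NP; rewrite /= sub0r normrN ger0_norm//.
  by rewrite (le_trans (ltW (rho0 n))).
have stable N x y : (forall n, (N <= n)%N -> ~ (B n x /\ B n y)) ->
    forall n, (N <= n)%N -> d n x y = d N x y.
  move=> H; elim=> [|n IH]; first by rewrite leqn0 => /eqP ->.
  rewrite leq_eqVlt => /orP[/eqP -> //|]; rewrite ltnS => Nn.
  by rewrite dS ?IH//; exact: H.
have rho_lt m n : (m < n)%N -> rho n < rho m.
  elim: n => // n IH; rewrite ltnS leq_eqVlt => /orP[/eqP -> //|/IH].
  exact: lt_trans.
have dout m x y : B m x -> ~ B m y -> forall n, (m <= n)%N -> rho m <= d n x y.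
  move=> Bx By; elim=> [|n IH].
    by rewrite leqn0 => /eqP m0; move: Bx By; rewrite m0; exact: dBout.
  rewrite leq_eqVlt => /orP[/eqP mn|]; first by rewrite -mn; apply: dBout.
  rewrite ltnS => mn; rewrite dS ?IH// => -[Bnx Bny].
  have mn' : (m < n)%N.
    by rewrite ltn_neqAle mn andbT; apply/eqP => mn'; apply: By; rewrite mn'.
  by have := dB _ _ _ Bnx Bny; rewrite leNgt (lt_le_trans (rho_lt _ _ mn')) ?IH.
have din m x y : B m x -> B m y -> forall n, (m < n)%N -> d n x y <= rho m.
  move=> Bx By; elim=> // n IH; rewrite ltnS leq_eqVlt => /orP[/eqP <-|mn].
    exact: dSB.
  have [[Bnx Bny]|nB] := pselect (B n x /\ B n y); last by rewrite dS ?IH.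
  by rewrite (le_trans (dSB _ _ _ Bnx Bny))// ltW// rho_lt.
(* Once [eps n] is below the initial distance of two distinct points, no [B n] contains both. *)
have ev x y : exists N, forall n, (N <= n)%N -> d n x y = d N x y.
  have [<-|/eqP xy] := eqVneq x y.
    by exists 0%N => n _; rewrite !ultrametric_refl.
  have [N NP] := eps0 _ (ultrametric_gt0 (d 0%N) _ _ xy).
  exists N; apply: stable => n Nn [Bx By].
  by have := d0B _ _ _ Bx By; rewrite leNgt NP.
have /choice[L LP] : forall xy : X * X, exists N, forall n, (N <= n)%N ->
  d n xy.1 xy.2 = d N xy.1 xy.2 by move=> [x y]; exact: ev.
pose f x y := d (L (x, y)) x y.
have fP x y : exists N, forall n, (N <= n)%N -> d n x y = f x y.
  by exists (L (x, y)); exact: (LP (x, y)).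
have fB m x y : B m x -> B m y -> f x y <= rho m.
  move=> Bx By; have [N NP] := fP x y.
  rewrite -(NP (maxn N m.+1)) ?leq_maxl// din// leq_max ltnSn orbT//.
have fout m x y : B m x -> ~ B m y -> rho m <= f x y.
  move=> Bx By; have [N NP] := fP x y.
  by rewrite -(NP (maxn N m)) ?leq_maxl// dout// leq_maxr.
(* In the first case one [N] serves all [y], so balls of [f] around [x] are balls of [d N]. *)
have tail x : (exists N, forall y, f x y = d N x y) \/
    (forall N, exists m, (N <= m)%N /\ B m x).
  have [inf|/existsNP[N NB]] :=
    pselect (forall N, exists m, (N <= m)%N /\ B m x); first by right.
  left; exists N => y; have [K KP] := fP x y.
  rewrite -(KP (maxn K N)) ?leq_maxl// (stable N) ?leq_maxr// => n Nn [Bn _].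
  by apply: NB; exists n.
have [e eP] : exists e : ultrametrics S X, forall x y, e x y = f x y.
  apply: (ultrametrics_of f (d 0%N)).
  - by move=> x; exact: ultrametric_refl.
  - move=> x y; have [N NP] := fP x y; have [N' NP'] := fP y x.
    rewrite -(NP (maxn N N')) ?leq_maxl// -(NP' (maxn N N')) ?leq_maxr//.
    exact: ultrametric_sym.
  - move=> x y z; have [N NP] := fP x y; have [N' NP'] := fP x z.
    have [N2 NP2] := fP z y; pose K := maxn N (maxn N' N2).
    rewrite -(NP K) ?leq_maxl// -(NP' K) ?leq_max ?leqnn ?orbT//.
    rewrite -(NP2 K) ?leq_max ?leqnn ?orbT//; exact: ultrametricP.
  - by move=> x y; exact: ultrametric_valued.
  - move=> x t t0.
    have [[N fN]|inf] := tail x.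
      have [r r0 rP] := ultrametric_equivalent (d 0%N) (d N) x _ t0.
      by exists r => // y; rewrite fN; exact: rP.
    have [N NP] := eps0 _ t0; have [m [Nm Bm]] := inf N.
    have [r r0 rP] := ultrametric_in_open (d 0%N) _ _ (oB m) Bm.
    exists r => // y /rP By.
    by rewrite (le_lt_trans (fB _ _ _ Bm By))// (le_lt_trans (rho_eps m))// NP.
  - move=> x t t0.
    have [[N fN]|inf] := tail x.
      have [r r0 rP] := ultrametric_equivalent (d N) (d 0%N) x _ t0.
      by exists r => // y; rewrite fN; exact: rP.
    have [N NP] := eps0 _ t0; have [m [Nm Bm]] := inf N.
    exists (rho m) => // y fxy.
    have [By|/(fout _ _ _ Bm)] := pselect (B m y); last by rewrite leNgt fxy.
    by rewrite (le_lt_trans (d0B _ _ _ Bm By))// NP.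
by exists e => x y; have [N NP] := fP x y; exists N => n /NP; rewrite eP.
Qed.

End Limit.

(** * Infinitude of open sets *)

Section Points.
Local Open Scope ring_scope.
Context {R : realType} {S : range_set R} {X : topologicalType}.

Lemma ultrametric_finite_closed (d : ultrametrics S X) (A : set X) :
  finite_set A -> closed A.
Proof.
move: A; apply/accessible_finite_set_closed => x y /eqP xy.
exists [set z | d x z < d x y].
split; first exact: ultrametric_open_ball.
  by rewrite inE /= ultrametric_refl ultrametric_gt0.
by rewrite inE /= ltxx.
Qed.

(** Finite sets are closed, so every subset of a finite open set would be relatively open. *)
Lemma locally_non_discrete_infinite (d : ultrametrics S X) (U : set X) :
  locally_non_discrete X -> open U -> U !=set0 -> infinite_set U.
Proof.
move=> hnd oU U0 finU; apply: (hnd U oU U0) => A.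
exists (~` (set_val @` (~` A))).
  rewrite openC; apply: (ultrametric_finite_closed d).
  apply: sub_finite_set finU => _ [x _ <-]; exact: set_valP.
apply/seteqP; split => x /=.
  by move=> nA; apply: contrapT => Ax; apply: nA; exists x.
by move=> Ax [y nAy /val_inj xy]; apply: nAy; rewrite xy.
Qed.

Lemma infinite_set_injection (T : Type) (A : set T) (k : nat) :
  infinite_set A -> exists2 f : 'I_k -> T, injective f & forall i, A (f i).
Proof.
move=> /infiniteP/card_leP[f].
pose n (i : 'I_k) : [set: nat] := SigSub (mem_set (Logic.I : setT (val i))).
exists (fun i => set_val (f (n i))); last by move=> i; exact: set_valP.
by move=> i j /val_inj/(inj (mem_set Logic.I) (mem_set Logic.I))[/val_inj].
Qed.

End Points.

(** * One step of the construction *)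

Section Step.
Local Open Scope ring_scope.
Context {R : realType} {S : range_set R} {X : topologicalType}.
Context (GG : transmissible_parameter R).

Definition violates_in (U : set X) (q : tp_Q GG) (d : metrics R X) :=
  exists (z : tp_Z GG) (a : inj_seq (tp_G q) X),
    (forall i, U (a i)) /\ ~ tp_F q (tp_phi a z d).

(** [M] holds the points used earlier and, being finite, leaves room in [U]. [M'] adds the new
    witness points, so the violation survives every change of metric that fixes the distances within
    [M']. *)
Lemma implant_violation (hcc : countable_coinitiality S)
    (hnd : locally_non_discrete X) (hus : ultra_singular S GG)
    (d0 e : ultrametrics S X) (U M : set X) (q : tp_Q GG) (t : R) :
    open U -> U !=set0 -> finite_set M -> 0 < t ->
  exists (B : set X) (e' : ultrametrics S X) (M' : set X) (rho : R),
    [/\ [/\ finite_set M', 0 < rho, rho < t, M `<=` M' & open B],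
        [/\ forall x y, B x -> B y -> d0 x y <= t,
            forall x y, B x -> B y -> e x y <= rho,
            forall x y, B x -> ~ B y -> rho <= e x y,
            forall x y, B x -> B y -> e' x y <= rho &
            forall x y, ~ (B x /\ B y) -> e' x y = e x y],
        forall x, B x -> ~ M x &
        forall d : ultrametrics S X,
          (forall x y, M' x -> M' y -> d x y = e' x y) -> violates_in U q d].
Proof.
move=> oU U0 Mfin t0.
have [p [Up Mp]] : (U `\` M) !=set0.
  apply: infinite_setN0; apply: infinite_setD => //.
  exact: (locally_non_discrete_infinite d0).
pose V := U `&` ~` M `&` [set y | d0 p y < t].
have oV : open V.
  apply: openI; last exact: ultrametric_open_ball.
  by apply: openI => //; rewrite openC; exact: (ultrametric_finite_closed d0).
have [r r0 rV] : exists2 r, 0 < r & forall y, e p y < r -> V y.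
  apply: (ultrametric_in_open e) => //; split => //=.
  by rewrite ultrametric_refl.
(* Halving [t] gives [rho < t], so that successive radii decrease strictly. *)
pose rho := Num.min r (t / 2).
have rho0 : 0 < rho by rewrite lt_min r0/=; lra.
pose B := [set y | e p y < rho].
have BV : B `<=` V by move=> y; rewrite /B /= lt_min => /andP[/rV].
have oB : open B by exact: ultrametric_open_ball.
have Bp : B p by rewrite /B /= ultrametric_refl.
have [z [Y [dY [a [_ aY diamY nF]]]]] := hus q rho rho0.
have [f finj fB] := @infinite_set_injection X B (inj_seq_size a)
  (locally_non_discrete_infinite d0 _ hnd oB (ex_intro _ p Bp)).
have dY_rho y y' : dY y y' <= rho.
  rewrite -lee_fin; apply: le_trans diamY; apply: ereal_sup_ubound; right.
  by exists (y, y').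
have i0 := Ordinal (tp_G_gt0 (inj_seq_sizeP a)).
have [e' [e'out e'in e'f]] := implant_finite_space hcc e p rho Y dY (a i0)
  _ f a rho0 dY_rho finj (@inj_seqP _ _ a) fB.
(* As [a] enumerates [Y], choosing indices embeds [Y] by [f \o g], isometrically for [e']; (TP2)
   then transports the violation. *)
have /choice[g gP] := aY.
have ginj : injective g by move=> y y' gy; rewrite -(gP y) gy gP.
have fginj : injective (f \o g) by exact: inj_comp.
exists B, e', (M `|` range f), rho; split => //.
- split => //.
  + by rewrite finite_setU; split=> //; exact: finite_image.
  + by rewrite gt_min; apply/orP; right; lra.
- split => //.
  + move=> x y /BV[_ /= px] /BV[_ /= py].
    rewrite (le_trans (ultrametricP d0 x y p))// ge_max ultrametric_sym.
    by rewrite !ltW.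
  + move=> x y /= px py; rewrite (le_trans (ultrametricP e x y p))//.
    by rewrite ge_max ultrametric_sym !ltW.
  + move=> x y /= px /negP; rewrite -leNgt => py.
    have := le_trans py (ultrametricP e p y x).
    by rewrite le_max leNgt px.
- by move=> x /BV[[_]].
move=> d de'; exists z, (inj_seq_map fginj a); split.
  by move=> i /=; have /BV[[]] := fB (g (a i)).
rewrite (TP2 fginj (dB := dY))// => x y /=.
by rewrite de'; [rewrite e'f !gP|right; eexists..].
Qed.

End Step.

(** * Openness and density of the violation conditions *)

Section Final.
Local Open Scope ring_scope.
Context {R : realType} {S : range_set R} {X : topologicalType}.
Context (GG : transmissible_parameter R).

(** As distances are nonnegative, bounding each of [d], [e] by the maximum of the other and [t]
    gives [|d - e| <= t]. This makes (TP1), stated for the supremum distance, usable here. *)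
Lemma ball_UM_ball_M (d e : ultrametrics S X) (r : R) :
  ball_UM d r e -> ball_M d r e.
Proof.
move=> /ereal_inf_lt[t [tS de] tr]; apply: le_lt_trans tr.
have t0 : (0 <= t)%E.
  by case: tS => [->//|[s /range_set_ge0 s0 ->]]; rewrite lee_fin.
apply: ge_ereal_sup => _ [->//|[[x y] _ <-]] /=.
have [] := de x y; case: t t0 {tS de} => [t t0||//]; last by rewrite !leey.
have [d0 e0] := (ultrametric_ge0 d x y, ultrametric_ge0 e x y).
move: t0; rewrite -!EFin_max !lee_fin !le_max ler_distl => t0.
by move=> /orP[] ? /orP[] ?; apply/andP; split; lra.
Qed.

Lemma violates_in_open (U : set X) (q : tp_Q GG) :
  open [set d : ultrametrics S X | violates_in GG U q d].
Proof.
rewrite openE => d [z [a [aU nF]]].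
have oF : open (~` @tp_F R GG q) by rewrite openC; exact: tp_F_closed.
have /nbhs_ballP[r r0 rP] := @TP1 R GG q X a z (d : ultrametrics S X) _
  (open_nbhs_nbhs (conj oF nF)).
apply/nbhs_ballP; exists r => // e de; exists z, a; split => //.
by apply: rP; exact: ball_UM_ball_M.
Qed.

Lemma violates_in_mono (U V : set X) (q : tp_Q GG) (d : metrics R X) :
  U `<=` V -> violates_in GG U q d -> violates_in GG V q d.
Proof. by move=> UV [z [a [aU nF]]]; exists z, a; split => // i; exact: UV. Qed.

(** (TP2) along the inclusion moves tuples between [W] and the whole space. *)
Lemma anti_transmissible_restr (W : set X) (d : metrics R X) :
  anti_transmissible GG (restr_metric W d) <-> forall q, violates_in GG W q d.
Proof.
have vinj : injective (set_val : W -> X) by exact: val_inj.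
split=> [anti q|viol [q Hq]].
  apply: contrapT => nviol; apply: anti; exists q => z a.
  apply: contrapT => nF; apply: nviol; exists z, (inj_seq_map vinj a); split.
    by move=> i; exact: set_valP.
  by rewrite (TP2 vinj (dB := restr_metric W d)).
have [z [a [aW]]] := viol q; apply.
pose b (i : 'I_(inj_seq_size a)) : W := SigSub (mem_set (aW i)).
have binj : injective b by move=> i j [/(@inj_seqP _ _ a)].
rewrite (_ : a = inj_seq_map vinj (InjSeq (inj_seq_sizeP a) binj)).
  by rewrite (TP2 vinj (dB := restr_metric W d)).
(* Once [a] is unpacked, the two sequences differ only in their injectivity proofs. *)
case: a aW @b binj => n a Wn ainj aW b binj.
exact: (congr1 (@InjSeq _ _ n a Wn) (Prop_irrelevance _ _)).
Qed.

Lemma countable_enumeration (T : Type) (A : set T) :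
  countable A -> A !=set0 ->
  exists f : nat -> T,
    (forall n, A (f n)) /\ forall t, A t -> exists n, f n = t.
Proof.
move=> /countable_injP[g ginj] [t0 At0].
have /choice[f fP] n : exists t, A t /\ ((exists2 u, A u & g u = n) -> g t = n).
  have [[u Au gu]|nu] := pselect (exists2 u, A u & g u = n).
    by exists u.
  by exists t0; split.
exists f; split => [n|t At]; first by have [] := fP n.
exists (g t); have [Af gf] := fP (g t).
by apply: ginj; rewrite ?inE//; apply: gf; exists t.
Qed.

Lemma approximate_by_violations (hcc : countable_coinitiality S)
    (hnd : locally_non_discrete X) (hus : ultra_singular S GG)
    (U : nat -> set X) (q : nat -> tp_Q GG) (d : ultrametrics S X) (r : R) :
    (forall n, open (U n)) -> (forall n, U n !=set0) -> 0 < r ->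
  exists2 e, ball_UM d r e & forall n, violates_in GG (U n) (q n) e.
Proof.
move=> oU U0 r0.
have [u [Su u_dec ucvg]] := hcc.
have u_gt0 n : 0 < u n.
  by apply: le_lt_trans (u_dec n); exact: range_set_ge0 (Su _).
(* All changes occur at scales at most [u N], an element of [S], which bounds the distance from [d]
   to the limit. *)
have [N uN] : exists N, u N < r.
  have /cvgrPdist_lt/(_ _ r0)[N _ /(_ N (leqnn N))] := ucvg.
  by rewrite /= sub0r normrN gtr0_norm//; exists N.
pose eps n := u (N + n)%N.
pose state : Type := (ultrametrics S X * set X * R)%type.
pose ok (s : state) := finite_set s.1.2 /\ 0 < s.2.
pose good n (s : state) (B : set X) (s' : state) :=
   [/\ [/\ 0 < s'.2, s'.2 < s.2, s'.2 <= eps n, s.1.2 `<=` s'.1.2 & open B],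
       [/\ forall x y, B x -> B y -> d x y <= eps n,
           forall x y, B x -> B y -> s.1.1 x y <= s'.2,
           forall x y, B x -> ~ B y -> s'.2 <= s.1.1 x y,
           forall x y, B x -> B y -> s'.1.1 x y <= s'.2 &
           forall x y, ~ (B x /\ B y) -> s'.1.1 x y = s.1.1 x y],
       forall x, B x -> ~ s.1.2 x &
       forall e : ultrametrics S X,
         (forall x y, s'.1.2 x -> s'.1.2 y -> e x y = s'.1.1 x y) ->
         violates_in GG (U n) (q n) e].
(* A state holds the metric, the points used so far and the last radius. Where the invariant [ok]
   fails an arbitrary value is returned, so that choice gives a total transition function. *)
have step (ns : nat * state) : exists Bs : set X * state,
    ok ns.2 -> ok Bs.2 /\ good ns.1 ns.2 Bs.1 Bs.2.
  case: ns => n [[e M] rho].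
  have [[/= Mfin rho0]|nok] := pselect (ok (e, M, rho)); last first.
    by exists (setT, (e, M, rho)).
  have t0 : 0 < Num.min rho (eps n) by rewrite lt_min rho0; exact: u_gt0.
  have [B [e' [M' [rho' [[M'fin rho'0]]]]]] :=
    implant_violation GG hcc hnd hus d e (U n) M (q n) _ (oU n) (U0 n) Mfin t0.
  rewrite lt_min => /andP[rho'rho rho'eps] MM' oB [d_eps h1 h2 h3 h4] BM viol.
  exists (B, (e', M', rho')) => _; split => //; split => //.
    by split => //; exact: ltW.
  split => // x y Bx By.
  by have := d_eps x y Bx By; rewrite le_min => /andP[].
have [F FP] := choice step.
pose sigma := fix sigma n : state :=
  if n is m.+1 then (F (m, sigma m)).2 else (d, set0, r).
have sigma_ok n : ok (sigma n).
  elim: n => [|n /(FP (n, _))]; first by split; [exact: finite_set0|].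
  by case.
pose B n := (F (n, sigma n)).1.
pose D n := (sigma n).1.1; pose M n := (sigma n).1.2.
(* [B n] is chosen in passing to state [n.+1], which stores its radius. *)
pose rho n := (sigma n.+1).2.
have SP n : good n (sigma n) (B n) (sigma n.+1).
  by have [] := FP (n, sigma n) (sigma_ok n).
have [e eP] : exists e : ultrametrics S X,
    forall x y, exists N, forall n, (N <= n)%N -> D n x y = e x y.
  apply: (ultrametric_limit D B rho eps) => [n|n|n||n|n|n|n|n|n].
  - by have [[]] := SP n.
  - by have [[]] := SP n.+1.
  - by have [[]] := SP n.
  - exact: cvg_comp (cvg_addnl N) ucvg.
  - by have [[]] := SP n.
  - by have [_ []] := SP n.
  - by have [_ []] := SP n.
  - by have [_ []] := SP n.
  - by have [_ []] := SP n.
  - by have [_ []] := SP n.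
exists e.
  apply: le_lt_trans (_ : (u N)%:E < r%:E)%E; last by rewrite lte_fin.
  apply: ereal_inf_lbound; split; first by right; exists (u N).
  have eps_le n : eps n <= u N.
    elim: n => [|n IH]; first by rewrite /eps addn0.
    by apply: le_trans IH; rewrite /eps addnS ltW.
  (* For a pair in [B n] both the original and the new distance are at most [u N]; other pairs
     inherit the bounds. *)
  have dD n x y : d x y <= Num.max (D n x y) (u N) /\
      D n x y <= Num.max (d x y) (u N).
    elim: n => [|n [IH1 IH2]]; first by rewrite !le_max !lexx.
    have [[_ _ rho_eps _ _] [d_eps _ _ D_rho D_eq] _ _] := SP n.
    have [[Bx By]|nB] := pselect (B n x /\ B n y); last by rewrite D_eq.
    rewrite !le_max; split; apply/orP; right.
      exact: le_trans (d_eps _ _ Bx By) (eps_le n).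
    exact: le_trans (D_rho _ _ Bx By) (le_trans rho_eps (eps_le n)).
  move=> x y; have [K KP] := eP x y.
  by rewrite -!EFin_max !lee_fin -(KP K).
(* All later balls avoid [M n.+1], so the limit agrees there with [D n.+1]. *)
move=> n; have [_ _ _] := SP n; apply => x y Mx My.
have M_mono k z : M n.+1 z -> M (n.+1 + k)%N z.
  elim: k => [|k IH]; first by rewrite addn0.
  by rewrite addnS => /IH; have [[_ _ _ + _] _ _ _] := SP (n.+1 + k)%N; exact.
have D_const k : D (n.+1 + k)%N x y = D n.+1 x y.
  elim: k => [|k IH]; first by rewrite addn0.
  have [_ [_ _ _ _ D_eq] BM _] := SP (n.+1 + k)%N.
  by rewrite addnS D_eq// => -[/BM + _]; apply; exact: M_mono.
have [K KP] := eP x y.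
by rewrite -(KP (n.+1 + K)%N) ?D_const// leq_addl.
Qed.
End Final.

Theorem theorem7p7 (R : realType) (S : range_set R)
    (hqc : quasi_complete S) (hcc : countable_coinitiality S)
    (X : topologicalType)
    (hsc : @second_countable X) (hlc : locally_compact [set: X])
    (hnd : locally_non_discrete X) (hum : ultrametrizable S X)
    (GG : transmissible_parameter R) (hus : ultra_singular S GG) :
  let A : set (ultrametrics S X) :=
    [set d | local_property (@anti_transmissible R GG) d] in
  dense A /\ Gdelta A.
Proof.
move=> A; have [V Vcount [Vopen Vbase]] := hsc.
pose I := [set Wq : set X * tp_Q GG | V Wq.1 /\ Wq.1 !=set0].
(* Every nonempty open set contains a nonempty base set, and a violation in the smaller set is one
   in the larger. *)
have AI : A = [set d : ultrametrics S X |
    forall Wq, I Wq -> violates_in GG Wq.1 Wq.2 d].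
  apply/seteqP; split=> [d Ad [W q] [/= VW W0]|d Id W oW [x Wx]].
    have /anti_transmissible_restr := Ad W (Vopen _ VW) W0; exact.
  apply/anti_transmissible_restr => q.
  have /= [W' [VW' W'x] W'W] := Vbase x W (open_nbhs_nbhs (conj oW Wx)).
  apply: (violates_in_mono GG W') => //.
  by apply: (Id (W', q)); split; [|exists x].
(* If [I] is empty there is no condition and [A] is the whole space; otherwise [I] can be
   enumerated. *)
have [[i0 Ii0]|I0] := pselect (I !=set0); last first.
  have -> : A = setT.
    by rewrite AI; apply/seteqP; split => // d _ Wq IWq; case: I0; exists Wq.
  split; first by move=> O [d Od] _; exists d.
  by apply: open_Gdelta; exact: openT.
have Icount : countable I.
  apply: (@sub_countable _ _ _ (V `*` [set: tp_Q GG])).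
    by apply: subset_card_le => Wq [].
  by apply: countableX => //; exact: tp_Q_countable.
have [f [fI If]] := countable_enumeration _ _ Icount (ex_intro _ i0 Ii0).
have {i0 Ii0} Af : A = \bigcap_n [set d : ultrametrics S X |
    violates_in GG (f n).1 (f n).2 d].
  rewrite AI; apply/seteqP; split => d Hd; first by move=> n _; exact: Hd.
  by move=> Wq /If[n <-]; exact: Hd.
split; last first.
  by exists (fun n => [set d : ultrametrics S X |
    violates_in GG (f n).1 (f n).2 d]) => // n; exact: violates_in_open.
move=> O [d Od] oO.
have /nbhs_ballP[r /= r0 rO] := open_nbhs_nbhs (conj oO Od).
have [e de eviol] := approximate_by_violations GG hcc hnd hus
  (fun n => (f n).1) (fun n => (f n).2) d r (fun n => Vopen _ (fI n).1)
  (fun n => (fI n).2) r0.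
by exists e; split; [exact: rO|rewrite Af => n _; exact: eviol].
Qed.
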